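(* Let $t\ge 0$ and suppose the isolation condition $$P(\Theta_{t+1}\mid \Theta_t,\pi^\ast)=P(\Theta_{t+1}\mid \Theta_t)$$ holds, i.e. $\Theta_{t+1}$ is conditionally independent of $\pi^\ast$ given $\Theta_t$. Then $(\pi^\ast,\Theta_t,\Theta_{t+1})$ forms a Markov chain $\pi^\ast\to\Theta_t\to\Theta_{t+1}$, and consequently the mutual information satisfies $$I(\pi^\ast;\Theta_{t+1})\le I(\pi^\ast;\Theta_t).$$
   Context: Semantic space: $\mathcal{V}$ is a countable set of discrete tokens, $\mathcal{V}^n$ is the set of token sequences of length $n$, and $\mathcal{Z}=\bigcup_{n\ge1}\mathcal{V}^n$. The safety reference $\pi^\ast$ is a probability distribution on $\mathcal{Z}$. In this result it is regarded as a random element (with values in the space of probability distributions on $\mathcal{Z}$, with its standard Borel structure) defined on the same probability space as the system states. Agents: $P_\theta$, $\theta\in\mathbb{R}^d$, is a parametric family of probability distributions on $\mathcal{Z}$. The system has $M$ agents; at round $t$ agent $m$ has a parameter vector $\theta_t^{(m)}\in\mathbb{R}^d$, and the joint system state is the random element $\Theta_t=(\theta_t^{(1)},\dots,\theta_t^{(M)})\in(\mathbb{R}^d)^M$. Dynamics: fix weights $w_m\ge0$ with $\sum_{m=1}^M w_m=1$, and set $\bar P_t(z)=\sum_{m=1}^M w_mP_{\theta_t^{(m)}}(z)$. For a selection function $a_{\Theta_t}:\mathcal{Z}\to[0,1]$ depending only on $\Theta_t$, set $P_t(z)=a_{\Theta_t}(z)\bar P_t(z)/Z_t$ with $Z_t=\sum_{z\in\mathcal{Z}}a_{\Theta_t}(z)\bar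 P_t(z)$ (assumed positive). Given $\Theta_t$, a dataset $\mathcal{D}_{t+1}=\{z_i\}_{i=1}^N$ is drawn conditionally i.i.d. from $P_t$. Then each agent updates by maximum likelihood on this dataset: $\theta_{t+1}^{(m)}\in\arg\min_\theta\frac1N\sum_{i=1}^N[-\log P_\theta(z_i)]$. A triple $(X,Y,W)$ of random elements forms a Markov chain $X\to Y\to W$ if $X$ and $W$ are conditionally independent given $Y$. $I(X;Y)\in[0,\infty]$ denotes mutual information, i.e. the Kullback–Leibler divergence of the joint law of $(X,Y)$ from the product of its marginals. *)

(* Defs.v *)
From HB Require Import structures.
From mathcomp Require Import all_boot all_order all_algebra.
From mathcomp Require Import all_classical all_reals all_analysis.
Set Implicit Arguments.
Unset Strict Implicit.
Unset Printing Implicit Defensive.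
Import Order.TTheory GRing.Theory Num.Theory.
Import numFieldNormedType.Exports.
Local Open Scope classical_set_scope.
Local Open Scope ring_scope.

(** ** Random elements: conditioning and information *)

Section joint.
Context d d1 d2 (Om : measurableType d) (T1 : measurableType d1)
  (T2 : measurableType d2).

Definition joint (X : Om -> T1) (Y : Om -> T2) : Om -> T1 * T2 :=
  fun x => (X x, Y x).

Variables (X : {mfun Om >-> T1}) (Y : {mfun Om >-> T2}).

Lemma measurable_joint : measurable_fun [set: Om] (joint X Y).
Proof. exact: measurable_fun_pair. Qed.

HB.instance Definition _ := @isMeasurableFun.Build _ _ _ _ (joint X Y)
  measurable_joint.

End joint.

Section conditioning.
Context d (Om : measurableType d) (R : realType) (P : probability Om R).

(* [f] is a version of P(E | Y): it is sigma(Y)-measurable, P-integrable, and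
   has the same integral as the indicator of [E] over every event of sigma(Y).
   Versions always exist and are unique up to P-null sets, so identities
   between conditional probabilities are almost sure identities between
   versions. *)
Definition is_cond_prob dY (TY : measurableType dY) (Y : Om -> TY)
    (E : set Om) (f : Om -> R) : Prop :=
  [/\ measurable_fun [set: g_sigma_algebra_preimageType Y] f,
      P.-integrable [set: Om] (EFin \o f) &
      forall G : set Om, g_sigma_algebra_preimage Y G ->
        (\int[P]_(x in G) (f x)%:E = P (E `&` G))%E].

(* P(W | Y) = P(W | Y') *)
Definition same_cond_law dW dY dY' (TW : measurableType dW)
    (TY : measurableType dY) (TY' : measurableType dY')
    (W : Om -> TW) (Y : Om -> TY) (Y' : Om -> TY') : Prop :=
  forall C : set TW, measurable C -> exists f g : Om -> R,
    [/\ is_cond_prob Y (W @^-1` C) f, is_cond_prob Y' (W @^-1` C) g &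
        {ae P, forall x, f x = g x}].

(* X -> Y -> W: for all measurable A and C, almost surely
   P(X \in A, W \in C | Y) = P(X \in A | Y) P(W \in C | Y) *)
Definition markov_chain dX dY dW (TX : measurableType dX)
    (TY : measurableType dY) (TW : measurableType dW)
    (X : Om -> TX) (Y : Om -> TY) (W : Om -> TW) : Prop :=
  forall (A : set TX) (C : set TW), measurable A -> measurable C ->
  exists h f g : Om -> R,
    [/\ is_cond_prob Y (X @^-1` A `&` W @^-1` C) h,
        is_cond_prob Y (X @^-1` A) f,
        is_cond_prob Y (W @^-1` C) g &
        {ae P, forall x, h x = f x * g x}].

End conditioning.

Section information.
Local Open Scope ereal_scope.
Local Open Scope charge_scope.

(* The library's derivative need not be positive everywhere, but it is so
   outside of a [mu]-null set; [lne] only matters there. *)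
Definition kl_divergence d (T : measurableType d) (R : realType)
    (mu nu : probability T R) : \bar R :=
  if `[< mu `<< nu >]
  then \int[mu]_x lne ('d (charge_of_finite_measure mu) '/d nu x)
  else +oo.

Definition mutual_information d dX dY (Om : measurableType d)
    (TX : measurableType dX) (TY : measurableType dY) (R : realType)
    (P : probability Om R) (X : {RV P >-> TX}) (Y : {RV P >-> TY}) : \bar R :=
  kl_divergence (distribution P (joint X Y))
                (distribution P X \x distribution P Y).

End information.

(** ** The multi-agent system *)

Definition semantic_space (V : pointedType) : Type :=
  {s : seq V | (0 < size s)%N}.

HB.instance Definition _ (V : pointedType) :=
  Choice.copy (semantic_space V) {s : seq V | (0 < size s)%N}.

HB.instance Definition _ (V : pointedType) :=
  isPointed.Build (semantic_space V)
  (exist (fun s : seq V => (0 < size s)%N) [:: point] isT).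

HB.instance Definition _ (V : pointedType) :=
  @isMeasurable.Build default_measure_display
  (semantic_space V) (@discrete_measurable (semantic_space V))
  discrete_measurable0
  (@discrete_measurableC (semantic_space V))
  (@discrete_measurableU (semantic_space V)).

(* The library equips tuples with the product sigma-algebra; over [R] this is
   the Borel sigma-algebra of R^d. *)
Notation param R d := (d.-tuple R).
Notation state R d M := (M.-tuple (param R d)).

Section system.
Context (R : realType) (V : pointedType) (d M N : nat).
Local Notation Z := (semantic_space V).
Variable Pth : param R d -> probability Z R.
Variable w : 'I_M -> R.
Variable a : state R d M -> Z -> R.

Definition mixture (T : state R d M) (z : Z) : R :=
  \sum_(m < M) w m * fine (Pth (tnth T m) [set z]).

(* The sum is at most 1 when 0 <= a <= 1 and [w] is a probability vector, so
   that [fine] discards nothing. *)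
Definition normalizer (T : state R d M) : R :=
  fine (\esum_(z in [set: Z]) (a T z * mixture T z)%:E)%E.

Definition selected (T : state R d M) (z : Z) : R :=
  a T z * mixture T z / normalizer T.

(* Extended-real valued: -log 0 = +oo. *)
Definition empirical_loss (s : N.-tuple Z) (theta : param R d) : \bar R :=
  ((N%:R^-1)%:E * \sum_(i < N) - lne (Pth theta [set tnth s i]))%E.

Definition is_mle (s : N.-tuple Z) (theta : param R d) : Prop :=
  forall theta', (empirical_loss s theta <= empirical_loss s theta')%E.

Context dO (Om : measurableType dO) (P : probability Om R).

Record dynamics (Theta : nat -> {RV P >-> state R d M})
    (D : nat -> {RV P >-> N.-tuple Z}) : Prop := {
  weight_ge0 : forall m, 0 <= w m ;
  weight_sum1 : \sum_(m < M) w m = 1 ;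
  selection_01 : forall T z, 0 <= a T z <= 1 ;
  normalizer_gt0 : forall t, {ae P, forall x, 0 < normalizer (Theta t x)} ;
  sampling : forall t (s : N.-tuple Z),
    is_cond_prob P (Theta t) [set x | D t.+1 x = s]
      (fun x => \prod_(i < N) selected (Theta t x) (tnth s i)) ;
  training : forall t m,
    {ae P, forall x, is_mle (D t.+1 x) (tnth (Theta t.+1 x) m)}
}.

End system.

(* Main.v *)
Require Import Defs.
From HB Require Import structures.
From mathcomp Require Import all_boot all_order all_algebra.
From mathcomp Require Import all_classical all_reals all_analysis.
From mathcomp Require Import measurable_realfun lra.
Set Implicit Arguments.
Unset Strict Implicit.
Unset Printing Implicit Defensive.
Import Order.TTheory GRing.Theory Num.Theory.
Import numFieldNormedType.Exports.
Local Open Scope classical_set_scope.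
Local Open Scope ring_scope.

(* Write X, Y, W for pistar, Theta_t, Theta_(t+1).

   Isolation gives k_C(Y) = P(W \in C | Y) = P(W \in C | X, Y), so integrating
   P(X \in A | Y) k_C(Y) over an event of sigma(Y) yields the conditional
   probability of {X \in A, W \in C}: this is the Markov property.

   If P_XY has density rho with respect to P_X (x) P_Y, then, by the Markov
   property, the law of ((X, Y), W) has the density rho(x, y) with respect to
   the law Q of ((x, Y), W) under P_X (x) P. Hence P_XW << P_X (x) P_W, say with
   density eta, and E[eta(X, W) / rho(X, Y)] <= Q-integral of eta = 1. The
   inequality E[ln eta(X, W)] <= E[ln rho(X, Y)] now follows from
   ln u <= u - 1 at u = eta(X, W) / rho(X, Y); the negative parts of both
   logarithms are integrable because (ln rho)^- <= 1 / rho and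
   E[1 / rho(X, Y)] <= 1. *)

(** * Real-valued densities and change of measure *)

Section density.
Local Open Scope ereal_scope.
Context d (T : measurableType d) (R : realType).
Implicit Types (mu : {sigma_finite_measure set T -> \bar R})
  (nu : {finite_measure set T -> \bar R}) (r : T -> R).

(** Finiteness and nonnegativity hold everywhere, not only almost everywhere, so quotients and
    logarithms of densities can be handled pointwise. *)
Definition is_density (mu nu : set T -> \bar R) (r : T -> R) : Prop :=
  [/\ measurable_fun [set: T] r, (forall x, (0 <= r x)%R) &
      forall A, measurable A -> nu A = \int[mu]_(x in A) (r x)%:E].

Lemma density_dominates (mu : {measure set T -> \bar R}) nu r :
  is_density mu nu r -> nu `<< mu.
Proof.
move=> [mr r0 nuE]; apply/null_content_dominatesP => A mA muA0.
rewrite nuE// null_set_integral//.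
exact/measurable_EFinP/measurable_funTS.
Qed.

(** The second conclusion links the density to the derivative that occurs in [kl_divergence]. *)
Lemma density_ex mu nu : nu `<< mu -> exists r, is_density mu nu r /\
  ae_eq mu [set: T] (EFin \o r)
    (Radon_Nikodym (charge_of_finite_measure nu) mu).
Proof.
move=> numu; have f0 := Radon_Nikodym_SigmaFinite.f_ge0 numu.
have ff := Radon_Nikodym_SigmaFinite.f_fin_num numu.
have mf := measurable_int _ (Radon_Nikodym_SigmaFinite.f_integrable numu).
exists (fine \o Radon_Nikodym_SigmaFinite.f nu mu); split; first split.
- by apply: measurableT_comp mf.
- by move=> x /=; exact/fine_ge0.
- move=> A mA; rewrite (Radon_Nikodym_SigmaFinite.f_integral numu mA).
  by apply: eq_integral => x _ /=; rewrite fineK.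
- have := ae_eq_Radon_Nikodym_SigmaFinite numu measurableT.
  by apply: filterS => x H _ /=; rewrite fineK// H.
Qed.

Lemma ge0_integral_density mu nu r (phi : T -> \bar R) :
  is_density mu nu r -> measurable_fun [set: T] phi -> (forall x, 0 <= phi x) ->
  \int[nu]_x phi x = \int[mu]_x (phi x * (r x)%:E).
Proof.
move=> dr mphi phi0; have [mr r0 nuE] := dr.
have numu := density_dominates dr.
have mf := measurable_int _ (Radon_Nikodym_SigmaFinite.f_integrable numu).
rewrite -(Radon_Nikodym_SigmaFinite.change_of_variables numu phi0)//.
apply: ae_eq_integral => //.
- exact: emeasurable_funM.
- by apply: emeasurable_funM => //; exact/measurable_EFinP.
(* Any density agrees almost everywhere with the Radon-Nikodym derivative, since both integrate to
   [nu] over every measurable set. *)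
- apply: ae_eqe_mul2l; apply: integral_ae_eq => //.
  + exact: Radon_Nikodym_SigmaFinite.f_integrable.
  + exact/measurable_EFinP.
  + by move=> A _ mA; rewrite -Radon_Nikodym_SigmaFinite.f_integral// nuE.
Qed.

Lemma density_gt0 mu nu r : is_density mu nu r ->
  {ae nu, forall x, (0 < r x)%R}.
Proof.
move=> [mr r0 nuE]; exists (r @^-1` [set 0%R]).
have m0 : measurable (r @^-1` [set 0%R]).
  by rewrite -[X in measurable X]setTI; exact: mr.
split => //.
- by rewrite nuE// integral0_eq// => x /= ->.
- by move=> x /= /negP; rewrite -leNgt => h; apply/eqP; rewrite eq_le h r0.
Qed.

(* Real inversion is continuous only away from 0, where it has the junk value
   0; [powR_inv1] identifies it there with the measurable [powR]. *)
Lemma measurable_funV (f : T -> R) : measurable_fun [set: T] f ->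
  (forall x, (0 <= f x)%R) -> measurable_fun [set: T] (fun x => (f x)^-1)%R.
Proof.
move=> mf f0; under eq_fun do rewrite -powR_inv1//.
exact: measurableT_comp (measurable_powR _) mf.
Qed.

(* Only an inequality: the left-hand side misses the set where [r] vanishes. *)
Lemma le_integral_div_density mu nu r (f : T -> R) : is_density mu nu r ->
  measurable_fun [set: T] f -> (forall x, (0 <= f x)%R) ->
  \int[nu]_x (f x / r x)%:E <= \int[mu]_x (f x)%:E.
Proof.
move=> dr mf f0; have [mr r0 nuE] := dr.
have mfr : measurable_fun [set: T] (fun x => (f x / r x)%R).
  by apply: measurable_funM => //; exact: measurable_funV.
rewrite (ge0_integral_density dr); [|exact/measurable_EFinP|]; last first.
  by move=> x; rewrite lee_fin divr_ge0.
apply: ge0_le_integral => //=.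
- by move=> x _; rewrite -EFinM lee_fin mulr_ge0// divr_ge0.
- under eq_fun do rewrite -EFinM.
  by apply/measurable_EFinP; exact: measurable_funM.
- exact/measurable_EFinP.
- move=> x _; rewrite -EFinM lee_fin.
  by have [->|rx] := eqVneq (r x) 0%R; rewrite ?mulr0// divfK.
Qed.

End density.

(** * Uniqueness of finite measures on a product *)

Section measure_prod.
Local Open Scope ereal_scope.
Context d1 d2 (T1 : measurableType d1) (T2 : measurableType d2) (R : realType).

(** Rectangles are stable under intersection and generate the product sigma-algebra. *)
Lemma eq_measure_prod (m1 m2 : {measure set (T1 * T2) -> \bar R}) :
  m1 [set: T1 * T2] < +oo ->
  (forall A B, measurable A -> measurable B -> m1 (A `*` B) = m2 (A `*` B)) ->
  forall S, measurable S -> m1 S = m2 S.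
Proof.
move=> m1oo m12.
pose C : set (set (T1 * T2)) :=
  [set A `*` B | A in measurable & B in measurable].
apply: (measure_unique C (fun=> setT)) => //.
- by rewrite measurable_prod_measurableType.
- move=> _ _ [A mA [B mB <-]] [A' mA' [B' mB' <-]].
  rewrite -setXI; exists (A `&` A'); first exact: measurableI.
  by exists (B `&` B'); first exact: measurableI.
- by move=> _; exists setT => //; exists setT => //; rewrite setXTT.
- by rewrite bigcup_const.
- by move=> _ [A mA [B mB <-]]; exact: m12.
Qed.

End measure_prod.

(** * Restriction of a probability to an event *)

Section restriction.
Local Open Scope ereal_scope.
Context d (T : measurableType d) (R : realType) (P : probability T R)
  (E : set T) (mE : measurable E).

Let fin_mrestr : fin_num_fun (mrestr P mE).
Proof.
by move=> A mA; rewrite /mrestr fin_num_measure//; exact: measurableI.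
Qed.

HB.instance Definition _ :=
  Measure_isFinite.Build _ _ _ (mrestr P mE) fin_mrestr.

Lemma mrestr_density : is_density P (mrestr P mE) \1_E.
Proof.
split => // A mA.
by rewrite integral_indic// setIC.
Qed.

Lemma ge0_integral_mrestr (f : T -> \bar R) : measurable_fun [set: T] f ->
  (forall x, 0 <= f x) -> \int[mrestr P mE]_x f x = \int[P]_(x in E) f x.
Proof.
move=> mf f0; rewrite (ge0_integral_density mrestr_density)//.
by rewrite -[in RHS](setTI E) integral_mkcondr epatch_indic.
Qed.

End restriction.

(** * Conditional probabilities as functions of the conditioning variable *)

Section conditional_probability.
Local Open Scope ereal_scope.
Context d dY (Om : measurableType d) (TY : measurableType dY) (R : realType)
  (P : probability Om R) (Y : {RV P >-> TY}).

Lemma sigma_preimageP (G : set Om) : g_sigma_algebra_preimage Y G <->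
  exists2 B, measurable B & G = Y @^-1` B.
Proof.
by split=> [[B mB <-]|[B mB ->]]; exists B => //; rewrite setTI.
Qed.

Lemma measurable_sigma_preimage dT (T : measurableType dT) (k : TY -> T) :
  measurable_fun [set: TY] k ->
  measurable_fun [set: g_sigma_algebra_preimageType Y] (k \o Y).
Proof.
move=> mk _ B mB; rewrite setTI; apply/sigma_preimageP.
by exists (k @^-1` B) => //; rewrite -[X in measurable X]setTI; exact: mk.
Qed.

Lemma cond_prob_comp (E : set Om) (k : TY -> R) : measurable E ->
  measurable_fun [set: TY] k -> (forall y, (0 <= k y)%R) ->
  (forall B, measurable B ->
    \int[P]_(x in Y @^-1` B) (k (Y x))%:E = P (E `&` Y @^-1` B)) ->
  is_cond_prob P Y E (k \o Y).
Proof.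
move=> mE mk k0 kE; split.
- exact: measurable_sigma_preimage.
- apply/integrableP; split.
    by apply/measurable_EFinP; exact: measurableT_comp mk _.
  under eq_integral => x _ do rewrite /= ger0_norm//.
  (* Integrability is the case of the whole space, where the integral is [P E]. *)
  have := kE _ measurableT; rewrite preimage_setT => ->.
  by rewrite setIT ltey_eq fin_num_measure.
- by move=> G /sigma_preimageP[B mB ->]; exact: kE.
Qed.

Section existence.
Variables (E : set Om) (mE : measurable E).

(** The measure of [B] is P(E, Y in B); its density with respect to the law of [Y] is P(E | Y =
    y). *)
Definition sublaw := pushforward (mrestr P mE) Y.

Let sublaw0 : sublaw set0 = 0.
Proof. exact: measure0. Qed.

Let sublaw_ge0 A : 0 <= sublaw A.
Proof. exact: measure_ge0. Qed.

Let sublaw_sigma_additive : semi_sigma_additive sublaw.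
Proof. exact: measure_semi_sigma_additive. Qed.

HB.instance Definition _ := isMeasure.Build _ _ _ sublaw
  sublaw0 sublaw_ge0 sublaw_sigma_additive.

Let fin_sublaw : fin_num_fun sublaw.
Proof.
move=> A mA; rewrite /sublaw /pushforward fin_num_measure//.
exact: measurable_funPTI.
Qed.

HB.instance Definition _ := Measure_isFinite.Build _ _ _ sublaw fin_sublaw.

(** The last clause is the pull-out property: the event [E] can be exchanged for the factor
    [k (Y x)] against any nonnegative function of [Y]. *)
Lemma cond_density_ex : exists k : TY -> R,
  [/\ measurable_fun [set: TY] k, (forall y, (0 <= k y)%R),
      is_cond_prob P Y E (k \o Y) &
      forall psi : TY -> \bar R, measurable_fun [set: TY] psi ->
        (forall y, 0 <= psi y) ->
      \int[P]_(x in E) psi (Y x) = \int[P]_x (psi (Y x) * (k (Y x))%:E)].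
Proof.
(* The sublaw is bounded by the law of [Y]. *)
have dom : sublaw `<< distribution P Y.
  apply/null_content_dominatesP => A mA A0.
  apply/eqP; rewrite eq_le measure_ge0 andbT -A0.
  rewrite /sublaw /distribution /pushforward /mrestr.
  have mYA : measurable (Y @^-1` A) by exact: measurable_funPTI.
  by apply: le_measure; rewrite ?inE//; exact: measurableI.
have [k [dk _]] := density_ex dom.
have [mk k0 _] := dk.
have kE psi : measurable_fun [set: TY] psi -> (forall y, 0 <= psi y) ->
    \int[P]_(x in E) psi (Y x) = \int[P]_x (psi (Y x) * (k (Y x))%:E).
  move=> mpsi psi0.
  have mpsiY : measurable_fun [set: Om] (fun x => psi (Y x)).
    exact: measurableT_comp mpsi _.
  rewrite -(ge0_integral_mrestr P mE)//.
  transitivity (\int[sublaw]_y psi y).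
    by rewrite ge0_integral_pushforward.
  rewrite (ge0_integral_density dk)// ge0_integral_distribution//.
  - by apply: emeasurable_funM => //; exact/measurable_EFinP.
  - by move=> y; rewrite mule_ge0// lee_fin.
exists k; split => //; apply: cond_prob_comp => // B mB.
have mYB : measurable (Y @^-1` B) by exact: measurable_funPTI.
rewrite setIC -integral_indic//.
transitivity (\int[P]_x ((\1_B (Y x))%:E * (k (Y x))%:E)).
  rewrite integral_mkcond; apply: eq_integral => x _.
  by rewrite epatch_indic muleC.
rewrite -(kE (EFin \o \1_B))//; first exact/measurable_EFinP.
by move=> y; rewrite lee_fin.
Qed.

End existence.

(* The identity seen as a random element with values in (Om, sigma(Y)); its
   distribution is the restriction of [P] to sigma(Y). *)
Let idY : Om -> g_sigma_algebra_preimageType Y := id.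

Let measurable_idY : measurable_fun [set: Om] idY.
Proof.
move=> _ G /sigma_preimageP[B mB ->]; exact: measurable_funP.
Qed.

HB.instance Definition _ := @isMeasurableFun.Build _ _ _ _ idY measurable_idY.

(** On (Om, sigma(Y)) both versions have the same integral over every measurable set, hence agree
    almost everywhere there; a null set of sigma(Y) is also null for [P]. *)
Lemma cond_prob_unique (E : set Om) (f g : Om -> R) :
  is_cond_prob P Y E f -> is_cond_prob P Y E g -> {ae P, forall x, f x = g x}.
Proof.
move=> [mf fi fE] [mg gi gE].
have push (h : Om -> R) G :
    measurable_fun [set: g_sigma_algebra_preimageType Y] h ->
    P.-integrable [set: Om] (EFin \o h) -> g_sigma_algebra_preimage Y G ->
    \int[distribution P idY]_(x in G) (h x)%:E = \int[P]_(x in G) (h x)%:E.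
  move=> mh ih mG; rewrite integral_pushforward//=; first exact/measurable_EFinP.
  apply: integrableS ih => //.
  by have := measurable_idY measurableT mG; rewrite setTI.
have : ae_eq (distribution P idY) [set: g_sigma_algebra_preimageType Y]
    (EFin \o f) (EFin \o g).
  apply: integral_ae_eq => //.
  - by apply: integrable_pushforward => //; exact/measurable_EFinP.
  - exact/measurable_EFinP.
  - by move=> G _ mG; rewrite !push// fE// gE.
move=> [N [mN N0 sN]]; exists N; split => //.
- by have := measurable_idY measurableT mN; rewrite setTI.
- move=> x /= fgx; apply: sN => /= h; apply: fgx.
  by have [] := h I.
Qed.

End conditional_probability.

(** * From isolation to the Markov property *)

Section isolation.
Local Open Scope ereal_scope.
Context d dX dY dW (Om : measurableType d) (TX : measurableType dX)
  (TY : measurableType dY) (TW : measurableType dW) (R : realType)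
  (P : probability Om R) (X : {RV P >-> TX}) (Y : {RV P >-> TY})
  (W : {RV P >-> TW}).
Hypothesis isolation : same_cond_law P W (joint Y X) Y.

(** Isolation enters in the last clause: [k \o Y] agrees almost surely with a version conditional on
    both variables, so it has the right integral over events of sigma(X, Y) too. *)
Lemma isolation_density (C : set TW) : measurable C -> exists k : TY -> R,
  [/\ measurable_fun [set: TY] k, (forall y, (0 <= k y)%R),
      (forall psi : TY -> \bar R, measurable_fun [set: TY] psi ->
        (forall y, 0 <= psi y) ->
      \int[P]_(x in W @^-1` C) psi (Y x) =
        \int[P]_x (psi (Y x) * (k (Y x))%:E)),
      is_cond_prob P Y (W @^-1` C) (k \o Y) &
      forall S : set (TX * TY), measurable S ->
        \int[P]_(x in joint X Y @^-1` S) (k (Y x))%:E =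
        P (joint X Y @^-1` S `&` W @^-1` C)].
Proof.
move=> mC.
have mWC : measurable (W @^-1` C) by exact: measurable_funPTI.
have [k [mk k0 kcp kE]] := cond_density_ex Y mWC.
have mkY : measurable_fun [set: Om] (fun x => k (Y x)).
  exact: measurableT_comp mk _.
exists k; split => // S mS.
have [f [g [fcp gcp fg]]] := isolation mC.
have gk := cond_prob_unique gcp kcp.
have [_ fi fE] := fcp.
have mS' : measurable (joint X Y @^-1` S).
  exact: (measurable_funPTI (joint X Y)).
rewrite setIC -fE.
  apply: ae_eq_integral => //.
  - exact/measurable_EFinP/measurable_funTS.
  - by apply: measurable_funTS; exact: measurable_int fi.
  - by move: fg gk; apply: filterS2 => x fgx gkx _ /=; rewrite fgx gkx.
(* Isolation conditions on [joint Y X], whereas [S] lives on the pairs in the order X, Y. *)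
exists ((fun p => (p.2, p.1)) @^-1` S); last by rewrite setTI.
by rewrite -[X in measurable X]setTI; exact: measurable_fun_pair.
Qed.

Lemma isolation_markov_chain : markov_chain P X Y W.
Proof.
move=> A C mA mC.
have mXA : measurable (X @^-1` A) by exact: measurable_funPTI.
have mWC : measurable (W @^-1` C) by exact: measurable_funPTI.
have [kC [mkC kC0 _ cpC kCE]] := isolation_density mC.
have [kA [mkA kA0 cpA kAE]] := cond_density_ex Y mXA.
exists ((fun y => kA y * kC y)%R \o Y), (kA \o Y), (kC \o Y).
split => //; last exact: aeW.
apply: cond_prob_comp.
- exact: measurableI.
- exact: measurable_funM.
- by move=> y; rewrite mulr_ge0.
move=> B mB.
transitivity (P (joint X Y @^-1` (A `*` B) `&` W @^-1` C)); last first.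
  by congr (P _); apply/seteqP; split => x /=; rewrite /joint/=; tauto.
rewrite -kCE; last exact: measurableX.
(* Pull-out for [kA], with the test function [\1_B * kC], turns the factor [kA] into the event that
   X lies in [A]. *)
transitivity (\int[P]_x ((\1_B (Y x) * kC (Y x))%:E * (kA (Y x))%:E)).
  rewrite integral_mkcond; apply: eq_integral => x _.
  rewrite epatch_indic /= -!EFinM; congr (_%:E).
  by rewrite mulrC mulrAC mulrA indicE.
rewrite -(kAE (fun y => (\1_B y * kC y)%:E)).
- rewrite integral_mkcond [RHS]integral_mkcond; apply: eq_integral => x _.
  rewrite !epatch_indic /= -!EFinM; congr (_%:E).
  have -> : \1_(joint X Y @^-1` (A `*` B)) x =
      (\1_(X @^-1` A) x * \1_B (Y x) : R)%R.
    by rewrite !indicE -natrM mulnb; congr (nat_of_bool _)%:R;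
      apply/idP/andP; rewrite !inE.
  by rewrite mulrCA mulrC (mulrC (kC _)).
- by apply/measurable_EFinP; apply: measurable_funM.
- by move=> y; rewrite lee_fin mulr_ge0.
Qed.

End isolation.

(** * The measure defined by a density *)

Section density_measure.
Local Open Scope ereal_scope.
Context d (T : measurableType d) (R : realType)
  (mu : {measure set T -> \bar R}) (r : T -> R).
Hypotheses (mr : measurable_fun [set: T] r) (r0 : forall x, (0 <= r x)%R).

(* The hypotheses are arguments so that the measure instance below can be
   inferred. *)
Definition density_measure & measurable_fun [set: T] r
    & (forall x, (0 <= r x)%R) :=
  fun A : set T => \int[mu]_(x in A) (r x)%:E.

Let nu := density_measure mr r0.

Let nu0 : nu set0 = 0.
Proof. exact: integral_set0. Qed.

Let nu_ge0 A : 0 <= nu A.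
Proof. by apply: integral_ge0 => x _; rewrite lee_fin. Qed.

Let nu_sigma_additive : semi_sigma_additive nu.
Proof.
apply: semi_sigma_additive_nng_induced; first exact/measurable_EFinP.
by move=> x; rewrite lee_fin.
Qed.

HB.instance Definition _ :=
  isMeasure.Build _ _ _ nu nu0 nu_ge0 nu_sigma_additive.

End density_measure.

(** * Divergence through densities, and logarithmic inequalities *)

Section kl.
Local Open Scope ereal_scope.
Context d (T : measurableType d) (R : realType).

Lemma measurable_lne_EFin (r : T -> R) : measurable_fun [set: T] r ->
  measurable_fun [set: T] (fun x => lne (r x)%:E).
Proof.
move=> mr; apply: (@measurableT_comp _ _ _ _ _ _ (fun x : R => lne x%:E)) mr.
rewrite /lne; apply: measurable_fun_ifT => //.
- exact: measurable_fun_ler.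
- by apply/measurable_EFinP; exact: measurable_ln.
Qed.

Lemma kl_density (mu nu : probability T R) : mu `<< nu -> exists r,
  is_density nu mu r /\ kl_divergence mu nu = \int[mu]_x lne (r x)%:E.
Proof.
move=> munu; have [r [dr rE]] := density_ex munu; exists r; split => //.
have [mr r0 _] := dr.
rewrite /kl_divergence asboolT//.
apply: ae_eq_integral => //.
- set q := Radon_Nikodym _ _.
  have mq : measurable_fun [set: T] q.
    by apply: measurable_int; apply: Radon_Nikodym_integrable.
  rewrite (_ : (fun x => _) = (fun x => lne (fine (q x))%:E)).
    by apply: measurable_lne_EFin; exact: measurableT_comp mq.
  by apply/funext => x; rewrite fineK// Radon_Nikodym_fin_num.
- exact: measurable_lne_EFin.
(* The two derivatives agree [nu]-almost everywhere, hence [mu]-almost everywhere by domination. *)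
- have := null_dominates_ae_eq measurableT munu rE.
  by apply: filterS => x H Tx; rewrite -(H Tx).
Qed.

Lemma ln_le_sub1 (u : R) : (0 < u)%R -> (ln u <= u - 1)%R.
Proof.
by move=> u0; rewrite -[in leLHS](subrK 1%R u) addrC le_ln1Dx// ltrBrDr addNr.
Qed.

Lemma funeneg_lne_le (r : R) : (0 < r)%R -> maxe (- lne r%:E) 0 <= (r^-1)%:E.
Proof.
move=> r0; rewrite lne_EFin// -EFinN -EFin_max lee_fin ge_max invr_ge0.
rewrite (ltW r0) andbT -lnV//.
by have /ln_le_sub1 : (0 < r^-1)%R; [rewrite invr_gt0|lra].
Qed.

(* [ln s - ln r <= s / r - 1], with all terms moved so that both sides are sums
   of nonnegative terms, which may be integrated without integrability
   conditions. *)
Lemma lne_sub_le (s r : R) : (0 < s)%R -> (0 < r)%R ->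
  maxe (lne s%:E) 0 + maxe (- lne r%:E) 0 + 1 <=
  maxe (- lne s%:E) 0 + maxe (lne r%:E) 0 + (s / r)%:E.
Proof.
move=> s0 r0; rewrite !lne_EFin// -!EFinN -!EFin_max -!EFinD lee_fin.
have /ln_le_sub1 : (0 < s / r)%R by exact: divr_gt0.
by rewrite ln_div// !maxEle; do 4 case: ifPn; rewrite -?ltNge; lra.
Qed.

End kl.

(** * Pulling the second factor of a product law back to the sample space *)

Section product_distribution.
Local Open Scope ereal_scope.
Context d dX dY (Om : measurableType d) (TX : measurableType dX)
  (TY : measurableType dY) (R : realType)
  (P : probability Om R) (mu : probability TX R) (Y : {RV P >-> TY}).

Lemma measurable_pair_snd :
  measurable_fun [set: TX * Om] (fun z => (z.1, Y z.2)).
Proof.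
apply: measurable_fun_pair => //.
by apply: measurableT_comp => //; exact: measurable_funP.
Qed.

Lemma ge0_integral_prod_distribution (f : TX * TY -> \bar R) :
  measurable_fun [set: TX * TY] f -> (forall z, 0 <= f z) ->
  \int[mu \x distribution P Y]_z f z = \int[mu \x P]_z f (z.1, Y z.2).
Proof.
move=> mf f0; rewrite !fubini_tonelli1//.
  apply: eq_integral => x _; rewrite /fubini_F ge0_integral_distribution//.
  exact: measurableT_comp mf _.
exact: measurableT_comp mf measurable_pair_snd.
Qed.

End product_distribution.

(** * Densities of the joint laws under isolation *)

Section data_processing.
Local Open Scope ereal_scope.
Context d dX dY dW (Om : measurableType d) (TX : measurableType dX)
  (TY : measurableType dY) (TW : measurableType dW) (R : realType)
  (P : probability Om R) (X : {RV P >-> TX}) (Y : {RV P >-> TY})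
  (W : {RV P >-> TW}).

Let T (z : TX * Om) : (TX * TY) * TW := ((z.1, Y z.2), W z.2).

Let mT : measurable_fun [set: TX * Om] T.
Proof.
apply: measurable_fun_pair; first exact: measurable_pair_snd.
by apply: measurableT_comp => //; exact: measurable_funP.
Qed.

HB.instance Definition _ := @isMeasurableFun.Build _ _ _ _ T mT.

Let pXP : probability (TX * Om)%type R := (distribution P X \x P)%E.
(** Here X is replaced by an independent copy, while [Y] and [W] are read off the same sample point
    and keep their joint law. *)
Let Q := distribution pXP T.

Variable rho : TX * TY -> R.
Let pXpY : probability (TX * TY)%type R :=
  (distribution P X \x distribution P Y)%E.
Hypothesis drho : is_density pXpY (distribution P (joint X Y)) rho.
Hypothesis isolation : same_cond_law P W (joint Y X) Y.

Lemma joint_law_density :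
  is_density Q (distribution P (joint (joint X Y) W)) (rho \o fst).
Proof.
have [mrho rho0 _] := drho.
have mr1 : measurable_fun [set: (TX * TY) * TW] (rho \o fst).
  exact: measurableT_comp.
have r10 z : (0 <= (rho \o @fst _ TW) z)%R by exact: rho0.
split; [exact: mr1|exact: r10|move=> A mA].
apply: (@eq_measure_prod _ _ _ _ _ (distribution P (joint (joint X Y) W))
  (density_measure Q mr1 r10)) A mA.
  by rewrite ltey_eq fin_num_measure.
move=> S C mS mC; rewrite /density_measure.
have [k [mk k0 kE _ lawE]] := isolation_density isolation mC.
have mSC := measurableX mS mC.
have mindS : measurable_fun [set: TX * TY] (\1_S : _ -> R) by [].
pose phi (z : TX * TY) := (\1_S z * k z.2)%:E.
have mphi : measurable_fun [set: TX * TY] phi.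
  apply/measurable_EFinP; apply: measurable_funM => //.
  exact: measurableT_comp.
have phi0 z : 0 <= phi z by rewrite lee_fin mulr_ge0.
pose psi (z : TX * TY) := (\1_S z * rho z)%:E.
have mpsi : measurable_fun [set: TX * TY] psi.
  by apply/measurable_EFinP; exact: measurable_funM.
have psi0 z : 0 <= psi z by rewrite lee_fin mulr_ge0.
(* Both sides reduce to this iterated integral: the law by isolation and the density [rho], the
   measure with density by Tonelli alone. *)
transitivity (\int[distribution P X]_x \int[P]_(o in W @^-1` C) psi (x, Y o)).
  transitivity (P (joint X Y @^-1` S `&` W @^-1` C)) => //.
  rewrite -lawE// integral_mkcond.
  transitivity (\int[P]_o phi (joint X Y o)).
    by apply: eq_integral => o _; rewrite epatch_indic /= /phi EFinM muleC.
  transitivity (\int[distribution P (joint X Y)]_z phi z).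
    by rewrite ge0_integral_distribution.
  have mphirho : measurable_fun [set: TX * TY] (fun z => phi z * (rho z)%:E).
    by apply: emeasurable_funM => //; exact/measurable_EFinP.
  have phirho0 z : 0 <= phi z * (rho z)%:E by rewrite mule_ge0// lee_fin.
  rewrite (ge0_integral_density drho mphi phi0).
  rewrite (ge0_integral_prod_distribution (distribution P X) Y mphirho phirho0).
  rewrite (@fubini_tonelli1 _ _ _ _ _ (distribution P X) P _
    (measurableT_comp mphirho (measurable_pair_snd Y))
    (fun z => phirho0 (z.1, Y z.2))).
  apply: eq_integral => x _; rewrite /fubini_F/=.
  (* For fixed [x], pull-out turns [k (Y o)] back into the event that W lies in [C], now with X
     independent. *)
  rewrite (kE (fun y => psi (x, y)))//; last exact: measurableT_comp.
  by apply: eq_integral => o _; rewrite /phi /psi/= -!EFinM mulrAC.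
rewrite [RHS]integral_mkcond.
under [RHS]eq_integral => z _ do rewrite epatch_indic.
pose g (z : (TX * TY) * TW) := (rho z.1)%:E * (\1_(S `*` C) z)%:E.
have mg : measurable_fun [set: (TX * TY) * TW] g.
  by apply: emeasurable_funM; exact/measurable_EFinP.
have g0 z : 0 <= g z by rewrite mule_ge0// lee_fin.
rewrite (ge0_integral_distribution T mg g0).
rewrite (@fubini_tonelli1 _ _ _ _ _ (distribution P X) P _
  (measurableT_comp mg mT) (fun z => g0 (T z))).
apply: eq_integral => x _; rewrite /fubini_F/= integral_mkcond.
apply: eq_integral => o _; rewrite epatch_indic /psi/= -!EFinM; congr (_%:E).
have -> : \1_(S `*` C) (T (x, o)) = (\1_S (x, Y o) * \1_(W @^-1` C) o : R)%R.
  by rewrite !indicE -natrM mulnb; congr (nat_of_bool _)%:R;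
    apply/idP/andP; rewrite !inE.
by rewrite mulrA (mulrC (rho _)).
Qed.

Let pXpW : probability (TX * TW)%type R :=
  (distribution P X \x distribution P W)%E.

Let measurable_fst_snd :
  measurable_fun [set: (TX * TY) * TW] (fun z => (z.1.1, z.2)).
Proof. by apply: measurable_fun_pair => //; exact: measurableT_comp. Qed.

(** Forgetting the [Y] coordinate maps the joint law to that of (X, W) and [Q] to [pXpW]; domination
    passes to images. *)
Lemma isolation_dominates : distribution P (joint X W) `<< pXpW.
Proof.
apply/null_content_dominatesP => A mA A0.
have mA' : measurable ((fun z : (TX * TY) * TW => (z.1.1, z.2)) @^-1` A).
  by rewrite -[X in measurable X]setTI; exact: measurable_fst_snd.
have := density_dominates joint_law_density.
move/null_content_dominatesP => /(_ _ mA'); apply.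
(* Both measures unfold to the integral over P_X of P (W \in A_x), with [A_x]
   the section of [A] at [x]. *)
exact: A0.
Qed.

(** Dividing by [rho] trades the joint law for [Q], under which [eta] integrates as under [pXpW], to
    total mass 1. *)
Lemma density_ratio_le1 (eta : TX * TW -> R) :
  is_density pXpW (distribution P (joint X W)) eta ->
  \int[P]_o (eta (X o, W o) / rho (X o, Y o))%:E <= 1.
Proof.
move=> deta; have [meta eta0 etaE] := deta.
have [mrho rho0 _] := drho.
pose f (z : (TX * TY) * TW) := eta (z.1.1, z.2).
have mf : measurable_fun [set: (TX * TY) * TW] f.
  exact: measurableT_comp meta measurable_fst_snd.
have f0 z : (0 <= f z)%R by exact: eta0.
have mfr : measurable_fun [set: (TX * TY) * TW] (fun z => (f z / rho z.1)%:E).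
  apply/measurable_EFinP/measurable_funM => //; apply: measurable_funV => //.
  exact: measurableT_comp.
have fr0 z : 0 <= (f z / rho z.1)%:E by rewrite lee_fin divr_ge0.
have := le_integral_div_density joint_law_density mf f0.
rewrite (ge0_integral_distribution (joint (joint X Y) W) mfr fr0).
move=> /le_trans; apply.
have mf' : measurable_fun [set: (TX * TY) * TW] (EFin \o f).
  exact/measurable_EFinP.
rewrite (ge0_integral_distribution T mf')//.
have meta' : measurable_fun [set: TX * TW] (EFin \o eta).
  exact/measurable_EFinP.
have eta0' z : 0 <= (EFin \o eta) z by rewrite lee_fin.
have := ge0_integral_prod_distribution (distribution P X) W meta' eta0'.
rewrite -[X in X = _](etaE _ measurableT) probability_setT => E1.
by rewrite [leRHS]E1.
Qed.

End data_processing.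

(** * Positive and negative parts of the logarithm of a density *)

Section log_density.
Local Open Scope ereal_scope.
Context d dT (Om : measurableType d) (T : measurableType dT) (R : realType)
  (P : probability Om R) (Z : {RV P >-> T}) (nu : probability T R) (r : T -> R).
Hypothesis dr : is_density nu (distribution P Z) r.

Let l (o : Om) := lne (r (Z o))%:E.

Lemma integral_lne_density :
  \int[distribution P Z]_z lne (r z)%:E = \int[P]_o l^\+ o - \int[P]_o l^\- o.
Proof.
have [mr _ _] := dr; have ml := measurable_lne_EFin mr.
rewrite integralE; congr (_ - _).
  rewrite (ge0_integral_distribution Z (measurable_funepos ml))//.
  by apply: eq_integral => o _; rewrite /= !funeposE.
rewrite (ge0_integral_distribution Z (measurable_funeneg ml))//.
by apply: eq_integral => o _; rewrite /= !funenegE.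
Qed.

Lemma density_distribution_gt0 : {ae P, forall o, (0 < r (Z o))%R}.
Proof.
have [N [mN N0 sN]] := density_gt0 dr; exists (Z @^-1` N); split => //.
  exact: measurable_funPTI.
by move=> o /= ro; exact: sN.
Qed.

Lemma integral_funeneg_lne_le1 : \int[P]_o l^\- o <= 1.
Proof.
have [mr r0 rE] := dr; have ml := measurable_lne_EFin mr.
have mV : measurable_fun [set: T] (fun z => (1 / r z)%:E).
  by apply/measurable_EFinP/measurable_funM => //; exact: measurable_funV.
have V0 z : 0 <= (1 / r z)%:E by rewrite lee_fin divr_ge0.
apply: (@le_trans _ _ (\int[P]_o (1 / r (Z o))%:E)).
  apply: ae_ge0_le_integral => //.
  - apply: measurable_funeneg.
    exact: (measurableT_comp ml (measurable_funP Z)).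
  - exact: (measurableT_comp mV (measurable_funP Z)).
  - apply: filterS density_distribution_gt0 => o ro _.
    by rewrite div1r funenegE; exact: funeneg_lne_le.
(* The constant numerator 1 bounds the expectation of [1 / r] by the total mass of [nu]. *)
have m1 : measurable_fun [set: T] (fun=> 1%R : R) by [].
have := le_integral_div_density dr m1 (fun=> ler01).
rewrite (ge0_integral_distribution Z mV V0) => /le_trans; apply.
by rewrite integral_cst// mul1e; exact: probability_le1.
Qed.

End log_density.

(** * The data processing inequality *)

Section mutual_information.
Local Open Scope ereal_scope.

Lemma isolation_mutual_information d dX dY dW (Om : measurableType d)
    (TX : measurableType dX) (TY : measurableType dY) (TW : measurableType dW)
    (R : realType) (P : probability Om R)
    (X : {RV P >-> TX}) (Y : {RV P >-> TY}) (W : {RV P >-> TW}) :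
  same_cond_law P W (joint Y X) Y ->
  mutual_information X W <= mutual_information X Y.
Proof.
move=> iso; rewrite /mutual_information.
(* Without domination the right-hand side is infinite. *)
have [dXY|ndXY] := pselect (distribution P (joint X Y) `<<
    (distribution P X \x distribution P Y)); last first.
  by rewrite [leRHS]/kl_divergence asboolF// leey.
have [rho [drho ->]] := kl_density dXY.
have [eta [deta ->]] := kl_density (isolation_dominates drho iso).
rewrite (integral_lne_density drho) (integral_lne_density deta).
have c1 := integral_funeneg_lne_le1 drho.
have b1 := integral_funeneg_lne_le1 deta.
have e1 := density_ratio_le1 drho iso deta.
have gt0rho := density_distribution_gt0 drho.
have gt0eta := density_distribution_gt0 deta.
have [mrho rho0 _] := drho; have [meta eta0 _] := deta.
have mr : measurable_fun [set: Om] (fun o => rho (joint X Y o)).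
  exact: (measurableT_comp mrho (measurable_funP (joint X Y))).
have ms : measurable_fun [set: Om] (fun o => eta (joint X W o)).
  exact: (measurableT_comp meta (measurable_funP (joint X W))).
have mlr := measurable_lne_EFin mr; have mls := measurable_lne_EFin ms.
have mpr := measurable_funepos mlr; have mnr := measurable_funeneg mlr.
have mps := measurable_funepos mls; have mns := measurable_funeneg mls.
have mq : measurable_fun [set: Om]
    (fun o => (eta (joint X W o) / rho (joint X Y o))%:E).
  by apply/measurable_EFinP/measurable_funM => //; exact: measurable_funV.
have q0 o : 0 <= (eta (joint X W o) / rho (joint X Y o))%:E.
  by rewrite lee_fin divr_ge0.
set lr := fun o => lne (rho (joint X Y o))%:E.
set ls := fun o => lne (eta (joint X W o))%:E.
have : \int[P]_o (ls^\+ o + lr^\- o + 1) <=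
    \int[P]_o (ls^\- o + lr^\+ o + (eta (joint X W o) / rho (joint X Y o))%:E).
  apply: ae_ge0_le_integral => //.
  - by move=> o _; rewrite !adde_ge0.
  - by apply: emeasurable_funD => //; exact: emeasurable_funD.
  - by move=> o _; rewrite !adde_ge0.
  - by apply: emeasurable_funD => //; exact: emeasurable_funD.
  - apply: filterS2 gt0rho gt0eta => o ro so _.
    by rewrite !funeposE !funenegE; exact: lne_sub_le.
rewrite !ge0_integralD//; last 4 first.
- by move=> o _; rewrite adde_ge0.
- exact: emeasurable_funD.
- by move=> o _; rewrite adde_ge0.
- exact: emeasurable_funD.
rewrite integral_cst// mul1e [X in _ + X](probability_setT P).
(* The positive parts may have infinite integrals, so only the integrals of the negative parts and
   the constant 1 are moved or cancelled. *)
have finB : \int[P]_o ls^\- o \is a fin_num.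
  by rewrite ge0_fin_numE ?integral_ge0// (le_lt_trans b1)// ltry.
have finC : \int[P]_o lr^\- o \is a fin_num.
  by rewrite ge0_fin_numE ?integral_ge0// (le_lt_trans c1)// ltry.
move=> /le_trans /(_ (leeD2l _ e1)); rewrite leeD2rE//.
by move=> ACBD; rewrite leeBlDr// addeAC leeBrDr// [leRHS]addeC.
Qed.

End mutual_information.

(** * Application to the safety reference and two consecutive system states *)

Theorem lemma2p4 (R : realType) (V : pointedType) (hV : countable [set: V])
    (dO : measure_display) (Om : measurableType dO) (P : probability Om R)
    (d M N : nat) (hN : (0 < N)%N)
    (Pth : param R d -> probability (semantic_space V) R)
    (w : 'I_M -> R)
    (a : state R d M -> semantic_space V -> R)
    (Theta : nat -> {RV P >-> state R d M})
    (D : nat -> {RV P >-> N.-tuple (semantic_space V)})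
    (pistar : {RV P >-> pprobability (semantic_space V) R})
    (hdyn : dynamics Pth w a Theta D)
    (t : nat)
    (hiso : same_cond_law P (Theta t.+1) (joint (Theta t) pistar) (Theta t)) :
  markov_chain P pistar (Theta t) (Theta t.+1) /\
  (mutual_information pistar (Theta t.+1)
     <= mutual_information pistar (Theta t))%E.
Proof.
split; first exact: isolation_markov_chain.
exact: isolation_mutual_information.
Qed.
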